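(* Let $n\ge 1$ and let $A\in SL(n,\mathbb{R})$. Then $$\int_{\mathbb{S}^{n-1}} \log\|Au\|\, d\sigma(u)\ \ge\ 0,$$ with equality if and only if $A^tA=I_n$.
   Context: $\mathbb{S}^{n-1}=\{u\in\mathbb{R}^n:\|u\|=1\}$ is the unit sphere of $\mathbb{R}^n$, $\|\cdot\|$ is the Euclidean norm, and $\sigma$ is the standard (rotation-invariant) measure on the unit sphere. *)

(* Defs.v *)
From HB Require Import structures.
From mathcomp Require Import all_boot all_order all_algebra.
From mathcomp Require Import all_classical all_reals all_analysis.

Set Implicit Arguments.
Unset Strict Implicit.
Unset Printing Implicit Defensive.

Import Order.TTheory GRing.Theory Num.Theory.
Import numFieldNormedType.Exports.

Local Open Scope classical_set_scope.
Local Open Scope ring_scope.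

(* The library's norm `|u| on 'cV[R]_n is the sup norm. *)
Definition enorm (R : realType) (n : nat) (u : 'cV[R]_n) : R :=
  Num.sqrt (\sum_(i < n) u i 0 ^+ 2).

Definition unit_sphere (R : realType) (n : nat) : set 'cV[R]_n :=
  [set u | enorm u = 1].

(* R^n with its Borel sigma-algebra: the topology of 'cV[R]_n is the usual
   one, all norms being equivalent. *)
Definition borelRn (R : realType) (n : nat) :=
  g_sigma_algebraType (@open 'cV[R]_n).

(* sigma is a finite nonzero Borel measure on the unit sphere, given as a Borel
   measure on R^n carried by the sphere, and invariant under O(n).  Such a
   measure is unique up to a positive factor, so it is the surface measure or a
   rescaling of it, e.g. to total mass 1.  O(n) is used rather than SO(n) so
   that this also holds for n = 1, where the sphere is {-1, 1} and SO(1) is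
   trivial. *)
Definition rotation_invariant_on_sphere (R : realType) (n : nat)
    (sigma : {measure set (borelRn R n) -> \bar R}) : Prop :=
  [/\ sigma (~` @unit_sphere R n) = 0%E,
      (0 < sigma (@unit_sphere R n) < +oo)%E
    & forall Q : 'M[R]_n, Q^T *m Q = 1%:M ->
      forall B : set (borelRn R n), measurable B ->
        sigma ((fun u : 'cV[R]_n => Q *m u) @^-1` B) = sigma B].

(* Main.v *)
Require Import Defs.
From HB Require Import structures.
From mathcomp Require Import all_boot all_order all_algebra.
From mathcomp Require Import all_classical all_reals all_analysis.
From mathcomp Require Import measurable_realfun complex ring lra.
Import Order.TTheory GRing.Theory Num.Theory.
Import numFieldNormedType.Exports.
Set Implicit Arguments.
Unset Strict Implicit.
Local Open Scope classical_set_scope.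
Local Open Scope ring_scope.

(** Let P = A^T A, a symmetric matrix of determinant 1.  It is diagonalized by
    an orthogonal matrix Q, say P = Q^T diag(d) Q, with all d_i > 0 and
    prod d_i = 1.  Substituting u = Q^T w, which preserves sigma, replaces
    |A u|^2 = u^T P u by sum_i d_i w_i^2.  The weights w_i^2 sum to 1 on the
    sphere, so Jensen's inequality for the concave function ln gives
      ln |A Q^T w| >= (1/2) sum_i w_i^2 ln d_i           (ln_jensen).
    By symmetry int w_i^2 has the same value K for every i (second_moment_eq),
    hence the right-hand side integrates to (K/2) ln (prod d_i) = 0.  This is
    the inequality (log_integral_diag).

    If the integral vanishes, Jensen's inequality is an equality for almost
    every w.  There d_i = d_j as soon as w_i and w_j are both nonzero, and for
    i != j this happens on a set of positive measure (coord_mul_not_ae_eq0).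
    So all d_i are equal, hence equal to 1, and P is the identity.

    The invariance of sigma is only ever applied to Q^T and to reflections, and
    reflections are also what makes the induction in the diagonalization of
    symmetric matrices work (symmetric_diagonalization). *)

(** * Inner product and reflections *)

Definition dot (R : comNzRingType) (n : nat) (u v : 'cV[R]_n) : R := (u^T *m v) 0 0.

Lemma dotE (R : comNzRingType) (n : nat) (u v : 'cV[R]_n) :
  dot u v = \sum_i u i 0 * v i 0.
Proof. by rewrite /dot mxE; apply: eq_bigr => i _; rewrite mxE. Qed.

Lemma dotC (R : comNzRingType) (n : nat) (u v : 'cV[R]_n) : dot u v = dot v u.
Proof. by rewrite !dotE; apply: eq_bigr => i _; rewrite mulrC. Qed.

Lemma dotBr (R : comNzRingType) (n : nat) (u v w : 'cV[R]_n) :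
  dot u (v - w) = dot u v - dot u w.
Proof. by rewrite /dot mulmxBr !mxE. Qed.

Lemma dot_mulmx (R : comNzRingType) (n : nat) (M : 'M[R]_n) (u v : 'cV[R]_n) :
  dot (M *m u) v = dot u (M^T *m v).
Proof. by rewrite /dot trmx_mul mulmxA. Qed.

Lemma dot_ge0 (R : realFieldType) (n : nat) (u : 'cV[R]_n) : 0 <= dot u u.
Proof. by rewrite dotE; apply: sumr_ge0 => i _; rewrite -expr2 sqr_ge0. Qed.

Lemma dot_eq0 (R : realFieldType) (n : nat) (u : 'cV[R]_n) :
  (dot u u == 0) = (u == 0).
Proof.
apply/idP/eqP => [|->]; last by rewrite /dot mulmx0 mxE eqxx.
rewrite dotE psumr_eq0 => [/allP u0|i _]; last by rewrite -expr2 sqr_ge0.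
apply/matrixP => i j; rewrite ord1 mxE; apply/eqP.
by have := u0 i (mem_index_enum i); rewrite mulf_eq0 orbb.
Qed.

(** If dot v v = 0 the inverse is 0 and this is the identity matrix, so that it
    is orthogonal for every v, with no nonvanishing condition. *)
Definition reflection (R : fieldType) (n : nat) (v : 'cV[R]_n) : 'M[R]_n :=
  1%:M - (2 / dot v v) *: (v *m v^T).

Lemma reflection_mul (R : fieldType) (n : nat) (v w : 'cV[R]_n) :
  reflection v *m w = w - (2 * dot v w / dot v v) *: v.
Proof.
rewrite /reflection mulmxBl mul1mx -scalemxAl -mulmxA.
rewrite [v^T *m w]mx11_scalar -/(dot v w) mul_mx_scalar scalerA.
by congr (_ - _ *: _); ring.
Qed.

Lemma trmx_reflection (R : fieldType) (n : nat) (v : 'cV[R]_n) :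
  (reflection v)^T = reflection v.
Proof. by rewrite /reflection linearB linearZ /= trmx1 trmx_mul trmxK. Qed.

Lemma reflection_orthogonal (R : fieldType) (n : nat) (v : 'cV[R]_n) :
  (reflection v)^T *m reflection v = 1%:M.
Proof.
rewrite trmx_reflection.
have [v0|vN0] := eqVneq (dot v v) 0.
  by rewrite /reflection v0 invr0 mulr0 scale0r subr0 mulmx1.
rewrite {2}/reflection mulmxBr mulmx1 -scalemxAr mulmxA reflection_mul.
rewrite mulfK // /reflection mulmxBl -scalemxAl [2 *: _]scaler_nat mulr2n opprD.
by rewrite addrA subrr sub0r scalerN opprK addrNK.
Qed.

(** The supply of orthogonal matrices: any two vectors of equal norm are
    exchanged by the reflection in their perpendicular bisector. *)
Lemma reflection_sub (R : realFieldType) (n : nat) (x y : 'cV[R]_n) :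
  dot x x = dot y y -> reflection (x - y) *m x = y.
Proof.
move=> xy; rewrite reflection_mul.
have [->|xNy] := eqVneq x y; first by rewrite subrr scaler0 subr0.
have e : dot (x - y) (x - y) = 2 * dot (x - y) x.
  rewrite dotBr (dotC (x - y) y) (dotC (x - y) x) !dotBr -xy (dotC y x); ring.
have N0 : dot (x - y) (x - y) != 0 by rewrite dot_eq0 subr_eq0.
by rewrite -e divff // scale1r opprB addrC addrNK.
Qed.

(** * Diagonalization of real symmetric matrices *)

(** Over R[i] the matrix is Hermitian, so its eigenvalues are real; a real root
    of the characteristic polynomial is an eigenvalue over R. *)
Lemma symmetric_eigenvalue (R : rcfType) (n : nat) (S : 'M[R]_n.+1) :
  S^T = S -> exists a, eigenvalue S a.
Proof.
move=> symS; pose f := (@real_complex R : {rmorphism R -> R[i]}).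
pose T := map_mx f S.
have hT : T \is hermsymmx.
  apply: realsym_hermsym.
    apply/is_hermitianmxP; rewrite expr0 scale1r; apply/matrixP => i j.
    by rewrite !mxE -{1}symS mxE.
  by apply/mxOverP => i j; rewrite mxE; apply/complex_realP; exists (S i j).
have [a Da] : exists a, spectral_diag T 0 0 = f a.
  by apply/complex_realP; have /mxOverP := hermitian_spectral_diag_real hT; exact.
have PT : spectralmx T *m T = diag_mx (spectral_diag T) *m spectralmx T.
  have /orthomx_spectralP := hermitian_normalmx hT.
  set P := spectralmx T; set d := spectral_diag T => ->.
  by rewrite !mulmxA mulmxV ?spectral_unit // mul1mx.
exists a; rewrite eigenvalue_root_char -(fmorph_root f) map_char_poly.
rewrite -eigenvalue_root_char.
apply/eigenvalueP; exists (row 0 (spectralmx T)).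
  by rewrite -row_mul PT; apply/rowP => j; rewrite mul_diag_mx !mxE Da.
apply/negP => /eqP r0; have := spectral_unit T.
rewrite -row_free_unit => /row_freeP[X].
move=> /(congr1 (row 0)); rewrite row_mul r0 mul0mx => /matrixP /(_ 0 0) /eqP.
by rewrite !mxE eqxx eq_sym oner_eq0.
Qed.

(** Induction on the size: a reflection H takes a unit eigenvector x to the
    first basis vector e, so e is an eigenvector of H S H.  Being symmetric,
    this matrix is then block diagonal with a 1 x 1 block, and the induction
    hypothesis diagonalizes the other block. *)
Lemma symmetric_diagonalization (R : rcfType) (n : nat) (S : 'M[R]_n) : S^T = S ->
  exists (Q : 'M[R]_n) (d : 'rV[R]_n),
    Q^T *m Q = 1%:M /\ S = Q^T *m diag_mx d *m Q.
Proof.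
elim: n S => [|n IHn] S symS.
  by exists 1%:M, 0; split; apply/matrixP; case.
have [a /eigenvalueP[v vS v0]] := symmetric_eigenvalue symS.
have vv0 : 0 < dot v^T v^T.
  rewrite lt_def dot_ge0 dot_eq0 andbT.
  by apply: contra v0 => /eqP vT0; rewrite -[v]trmxK vT0 trmx0.
pose c := (Num.sqrt (dot v^T v^T))^-1.
pose x := c *: v^T.
pose e : 'cV[R]_n.+1 := delta_mx 0 0.
have xe : dot x x = dot e e.
  have -> : dot e e = 1.
    by rewrite /dot trmx_delta mul_delta_mx mxE.
  have -> : dot x x = c ^+ 2 * dot v^T v^T.
    by rewrite !dotE mulr_sumr; apply: eq_bigr => i _; rewrite /x !mxE; ring.
  by rewrite /c exprVn sqr_sqrtr ?ltW // mulVf ?gt_eqF.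
have Sx : S *m x = a *: x.
  rewrite /x -scalemxAr -{1}symS -trmx_mul vS linearZ /= !scalerA.
  by congr (_ *: _); rewrite mulrC.
pose H := reflection (x - e).
have Hx : H *m x = e by exact: reflection_sub.
have HH : H *m H = 1%:M by rewrite -{1}[H]trmx_reflection reflection_orthogonal.
pose T : 'M[R]_(1 + n) := H *m S *m H.
have symT : T^T = T by rewrite /T !trmx_mul symS trmx_reflection mulmxA.
have Te : T *m e = a *: e.
  rewrite /T -Hx -!mulmxA [H *m (H *m x)]mulmxA HH mul1mx Sx.
  by rewrite -scalemxAr.
have ST : S = H *m T *m H.
  by rewrite /T !mulmxA HH mul1mx -mulmxA HH mulmx1.
(* T is made opaque so that mxE does not unfold it as a product. *)
clearbody T.
have T0 i : T i 0 = a * (i == 0)%:R.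
  have := congr1 (fun M : 'cV_n.+1 => M i 0) Te.
  by rewrite -colE !mxE eqxx andbT.
have ur : ursubmx T = 0.
  by apply/matrixP => i j; rewrite -symT !mxE ord1 lshift0 T0 mulr0.
have dl : dlsubmx T = 0.
  by apply/matrixP => i j; rewrite !mxE ord1 lshift0 T0 mulr0.
have [|Q [d [QQ TE]]] := IHn (drsubmx T).
  by rewrite trmx_drsub symT.
pose B : 'M[R]_(1 + n) := block_mx 1%:M 0 0 Q.
have BB : B^T *m B = 1%:M.
  rewrite tr_block_mx mulmx_block !(mulmx0, mul0mx, trmx0, addr0, add0r) QQ.
  by rewrite trmx1 mulmx1 -scalar_mx_block.
exists (B *m H), (row_mx (ulsubmx T) d : 'rV_(1 + n)); split.
  by rewrite trmx_mul mulmxA -(mulmxA _ _ B) BB mulmx1 trmx_reflection.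
rewrite ST.
have TB : T = B^T *m diag_mx (row_mx (ulsubmx T) d) *m B.
  rewrite diag_mx_row tr_block_mx !mulmx_block.
  rewrite !(mulmx0, mul0mx, trmx0, addr0, add0r) trmx1 mulmx1 mul1mx -TE.
  rewrite -[LHS]submxK ur dl; congr block_mx.
  by apply/matrixP => i j; rewrite !ord1 [RHS]mxE eqxx.
by rewrite {1}TB trmx_mul trmx_reflection !mulmxA.
Qed.

(** * Measurability on the Borel space *)

Lemma coord_measurable (R : realType) (n : nat) (i : 'I_n) :
  measurable_fun setT (fun u : borelRn R n => (u : 'cV[R]_n) i 0).
Proof.
apply: (measurability _ (RGenOpens.measurableE R)).
move=> _ [_ [a [b ->] <-]]; rewrite setTI; apply: sub_sigma_algebra.
by have /continuousP := @coord_continuous R n 1 i 0; apply; exact: interval_open.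
Qed.

(** Neighbourhoods of a matrix are generated by products of neighbourhoods of
    its entries, so continuity is checked entry by entry. *)
Lemma mulmx_continuous (R : realType) (n : nat) (Q : 'M[R]_n) :
  continuous (fun u : 'cV[R]_n => Q *m u).
Proof.
move=> u B [P Pu PB].
have nbhsP i : nbhs u [set v : 'cV[R]_n | P i 0 ((Q *m v) i 0)].
  have rowE v : (Q *m v) i 0 = \sum_j Q i j * v j 0 by rewrite mxE.
  have rowQ : continuous (fun v : 'cV[R]_n => \sum_j Q i j * v j 0).
    apply: (continuous_big (op := +%R)) => [|j _]; first exact: add_continuous.
    move=> v; have vj := @coord_continuous R n 1 j 0 v.
    exact: (cvgMl_tmp (g := fun v : 'cV[R]_n => v j 0) vj).
  have -> : [set v : 'cV[R]_n | P i 0 ((Q *m v) i 0)] =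
      (fun v : 'cV[R]_n => \sum_j Q i j * v j 0) @^-1` P i 0.
    by apply/seteqP; split => v /=; rewrite rowE.
  by have := Pu i 0; rewrite rowE => /rowQ.
have := filter_forall (nbhs_filter u) nbhsP.
apply: filterS => v Pv; apply: PB => i j.
by rewrite ord1; exact: Pv.
Qed.

Lemma mulmx_measurable (R : realType) (n : nat) (Q : 'M[R]_n) :
  measurable_fun setT (fun u : borelRn R n => Q *m u : borelRn R n).
Proof.
apply: (@measurability _ _ (borelRn R n) (borelRn R n) setT _
  (@open 'cV[R]_n : set (set (borelRn R n)))) => //.
move=> _ [B oB <-]; rewrite setTI; apply: sub_sigma_algebra.
by have /continuousP := @mulmx_continuous R n Q; exact.
Qed.

Lemma enorm_mulmx_measurable (R : realType) (n : nat) (M : 'M[R]_n) :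
  measurable_fun setT (fun u : borelRn R n => enorm (M *m u)).
Proof.
have msqrt : measurable_fun setT (Num.sqrt : R -> R).
  by apply: continuous_measurable_fun; exact: sqrt_continuous.
apply: (measurableT_comp msqrt).
apply: measurable_sum => i; apply: measurable_funX.
exact: (measurableT_comp (coord_measurable i) (mulmx_measurable M)).
Qed.

Lemma unit_sphere_measurable (R : realType) (n : nat) :
  measurable (@unit_sphere R n : set (borelRn R n)).
Proof.
have := enorm_mulmx_measurable (1%:M : 'M[R]_n) measurableT (measurable_set1 1).
rewrite setTI; congr measurable; apply/seteqP; split => u /=;
  by rewrite /unit_sphere /= mul1mx.
Qed.

(** * Integration over the sphere *)

Lemma enormE (R : realType) (n : nat) (u : 'cV[R]_n) : enorm u = Num.sqrt (dot u u).
Proof. by rewrite /enorm dotE. Qed.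

Lemma unit_sphereE (R : realType) (n : nat) (u : 'cV[R]_n) :
  unit_sphere u <-> dot u u = 1.
Proof.
rewrite /unit_sphere /= enormE; split => [h|->]; last exact: sqrtr1.
by rewrite -(sqr_sqrtr (dot_ge0 u)) h expr1n.
Qed.

Lemma orthogonal_sphere (R : realType) (n : nat) (Q : 'M[R]_n) (u : 'cV[R]_n) :
  Q^T *m Q = 1%:M -> unit_sphere (Q *m u) <-> unit_sphere u.
Proof. by move=> QQ; rewrite !unit_sphereE dot_mulmx mulmxA QQ mul1mx. Qed.

Lemma sphere_integrable (R : realType) (n : nat)
    (sigma : {measure set (borelRn R n) -> \bar R}) (f : borelRn R n -> R) (C : R) :
  rotation_invariant_on_sphere sigma -> measurable_fun setT f ->
  (forall u, unit_sphere u -> `|f u| <= C) ->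
  sigma.-integrable (@unit_sphere R n) (EFin \o f).
Proof.
move=> [_ /andP[_ fin] _] mf fC; apply: measurable_bounded_integrable => //.
- exact: unit_sphere_measurable.
- exact: measurable_funTS.
exists C; split; first exact: num_real.
by move=> x Cx u Su; apply: (le_trans (fC u Su)); exact: ltW.
Qed.

(** Only bounded integrands occur below, and boundedness on the sphere is
    enough for integrability because sigma is finite. *)
Lemma integral_orthogonal (R : realType) (n : nat)
    (sigma : {measure set (borelRn R n) -> \bar R}) (Q : 'M[R]_n)
    (f : borelRn R n -> R) (C : R) :
  rotation_invariant_on_sphere sigma -> Q^T *m Q = 1%:M ->
  measurable_fun setT f -> (forall u, unit_sphere u -> `|f u| <= C) ->
  (\int[sigma]_(u in @unit_sphere R n) (f (Q *m u))%:E =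
   \int[sigma]_(u in @unit_sphere R n) (f u)%:E)%E.
Proof.
move=> hsigma QQ mf fC; have [_ _ inv] := hsigma.
have mQ := mulmx_measurable Q.
have preS : (fun u : borelRn R n => Q *m u : borelRn R n) @^-1` @unit_sphere R n
    = @unit_sphere R n.
  by apply/seteqP; split => u; rewrite /preimage /=; have [] := orthogonal_sphere u QQ.
rewrite [RHS](eq_measure_integral
  (pushforward sigma (fun u : borelRn R n => Q *m u : borelRn R n))); last first.
  by move=> B mB _; rewrite /pushforward /=; apply/esym/inv.
rewrite (integral_pushforward mQ) ?preS //.
- by apply/measurable_EFinP.
- apply: (sphere_integrable (f := fun u : borelRn R n => f (Q *m u)) hsigma).
    exact: (measurableT_comp mf mQ).
  by move=> u Su; apply: fC; exact/(orthogonal_sphere u QQ).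
- exact: unit_sphere_measurable.
Qed.

Lemma coord_sqr_le1 (R : realType) (n : nat) (u : 'cV[R]_n) i :
  unit_sphere u -> u i 0 ^+ 2 <= 1.
Proof.
move=> /unit_sphereE; rewrite dotE (bigD1 i) //= -expr2 => <-.
by rewrite lerDl; apply: sumr_ge0 => j _; rewrite -expr2 sqr_ge0.
Qed.

Lemma coord_sqr_measurable (R : realType) (n : nat) (i : 'I_n) :
  measurable_fun setT (fun u : borelRn R n => (u : 'cV[R]_n) i 0 ^+ 2).
Proof. exact: measurable_funX (coord_measurable i). Qed.

(** The reflection exchanging the basis vectors e_i and e_j exchanges the two
    coordinates of u. *)
Lemma second_moment_eq (R : realType) (n : nat)
    (sigma : {measure set (borelRn R n) -> \bar R}) (i j : 'I_n) :
  rotation_invariant_on_sphere sigma ->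
  (\int[sigma]_(u in @unit_sphere R n) (u i 0 ^+ 2)%:E =
   \int[sigma]_(u in @unit_sphere R n) (u j 0 ^+ 2)%:E)%E.
Proof.
move=> hsigma.
pose e (k : 'I_n) : 'cV[R]_n := delta_mx k 0.
have e1 k : dot (e k) (e k) = 1 by rewrite /dot trmx_delta mul_delta_mx mxE !eqxx.
have coordE k (u : 'cV[R]_n) : u k 0 = dot (e k) u.
  by rewrite /dot trmx_delta -rowE mxE.
pose H : 'M[R]_n := reflection (e j - e i).
have Hj : H *m e j = e i by apply: reflection_sub; rewrite !e1.
rewrite -(integral_orthogonal (Q := H)
  (f := fun u : borelRn R n => u j 0 ^+ 2) (C := 1)) //.
- apply: eq_integral => u _; congr (_ ^+ 2)%:E.
  by rewrite !coordE -Hj dot_mulmx trmx_reflection.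
- exact: reflection_orthogonal.
- exact: coord_sqr_measurable.
- by move=> u Su; rewrite ger0_norm ?sqr_ge0 // coord_sqr_le1.
Qed.

(** The exceptional null set is replaced by its preimage under Q, which has the
    same measure. *)
Lemma ae_orthogonal (R : realType) (n : nat)
    (sigma : {measure set (borelRn R n) -> \bar R}) (Q : 'M[R]_n)
    (P : 'cV[R]_n -> Prop) :
  rotation_invariant_on_sphere sigma -> Q^T *m Q = 1%:M ->
  (\forall u \ae sigma, unit_sphere u -> P u) ->
  \forall u \ae sigma, unit_sphere u -> P (Q *m u).
Proof.
move=> [_ _ inv] QQ [N [mN N0 PN]].
exists ((fun u : borelRn R n => Q *m u : borelRn R n) @^-1` N); split.
- by rewrite -[X in measurable X]setTI; exact: mulmx_measurable.
- by rewrite -N0; exact: inv.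
move=> u nPQu; apply: PN => /= Pu; apply: nPQu => /= Su.
by apply: Pu; apply/(orthogonal_sphere u QQ).
Qed.

(** This is what turns a weighted sum of the ln d_i into ln (prod d_i). *)
Lemma integral_sum_coord_sqr (R : realType) (n : nat)
    (sigma : {measure set (borelRn R n) -> \bar R}) (c : 'I_n -> R) (k : 'I_n) :
  rotation_invariant_on_sphere sigma ->
  (\int[sigma]_(u in @unit_sphere R n) (\sum_i c i * u i 0 ^+ 2)%:E =
   (\sum_i c i)%:E * \int[sigma]_(u in @unit_sphere R n) (u k 0 ^+ 2)%:E)%E.
Proof.
move=> hsigma; have mS := @unit_sphere_measurable R n.
have intX i : sigma.-integrable (@unit_sphere R n)
    (EFin \o (fun u : borelRn R n => (u : 'cV[R]_n) i 0 ^+ 2)).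
  apply: (sphere_integrable (C := 1) hsigma); first exact: coord_sqr_measurable.
  by move=> u Su; rewrite ger0_norm ?sqr_ge0 // coord_sqr_le1.
under eq_integral do rewrite -sumEFin.
rewrite (integral_sum mS
  (f := fun i (u : borelRn R n) => (c i * (u : 'cV[R]_n) i 0 ^+ 2)%:E)); last first.
  by move=> i; exact: (integrableZl mS (c i) (intX i)).
have /fineK <- := integrable_fin_num mS (intX k).
rewrite -EFinM mulr_suml -sumEFin; apply: eq_bigr => i _.
rewrite (integralZl mS (intX i)) (second_moment_eq i k hsigma) EFinM.
by rewrite (fineK (integrable_fin_num mS (intX k))).
Qed.

(** Otherwise all second moments vanish, and they add up to the measure of the
    sphere. *)
Lemma coord_not_ae_eq0 (R : realType) (n : nat)
    (sigma : {measure set (borelRn R n) -> \bar R}) (i : 'I_n) :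
  rotation_invariant_on_sphere sigma ->
  ~ (\forall u \ae sigma, unit_sphere u -> (u : 'cV[R]_n) i 0 = 0).
Proof.
move=> hsigma ui0; have mS := @unit_sphere_measurable R n.
have [_ /andP[pos _] _] := hsigma.
have zero : (\int[sigma]_(u in @unit_sphere R n) (u i 0 ^+ 2)%:E = 0)%E.
  rewrite (ae_eq_integral (cst 0%E)) ?integral0 //.
    by apply/measurable_EFinP; apply: measurable_funTS; exact: coord_sqr_measurable.
  by apply: (@filterS _ _ (ae_filter_ringOfSetsType sigma)) ui0
    => u ui0 /ui0 ->; rewrite expr0n.
have one : (\int[sigma]_(u in @unit_sphere R n) (\sum_j 1 * u j 0 ^+ 2)%:E
    = sigma (@unit_sphere R n))%E.
  rewrite -[RHS]mul1e -(integral_cst _ mS); apply: eq_integral => u.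
  rewrite inE => /unit_sphereE uu; congr (_)%:E; rewrite -[RHS]uu dotE.
  by apply: eq_bigr => j _; rewrite mul1r.
by move: pos; rewrite -one (integral_sum_coord_sqr _ i hsigma) zero mule0 ltxx.
Qed.

(** If u_i u_j = 0 almost everywhere, then the same holds for the image of u
    under any reflection along a vector of the plane of e_i and e_j.  If it
    maps neither axis of this plane to an axis, the two equations force
    u_i = u_j = 0, which coord_not_ae_eq0 excludes. *)
Lemma coord_mul_not_ae_eq0 (R : realType) (n : nat)
    (sigma : {measure set (borelRn R n) -> \bar R}) (i j : 'I_n) :
  rotation_invariant_on_sphere sigma -> i != j ->
  ~ (\forall u \ae sigma,
       unit_sphere u -> (u : 'cV[R]_n) i 0 * (u : 'cV[R]_n) j 0 = 0).
Proof.
move=> hsigma ij uij; apply: (@coord_not_ae_eq0 _ _ sigma i hsigma).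
(* With v = 2 e_i + e_j the reflection has rational entries: u = a e_i is
   mapped to (-3 a e_i - 4 a e_j) / 5. *)
pose v : 'cV[R]_n := 2 *: delta_mx i 0 + delta_mx j 0.
have vi : v i 0 = 2 by rewrite !mxE !eqxx (negbTE ij) mulr1 addr0.
have vj : v j 0 = 1 by rewrite !mxE !eqxx eq_sym (negbTE ij) mulr0 add0r.
have dotv u : dot v u = 2 * u i 0 + u j 0.
  by rewrite /dot linearD linearZ /= mulmxDl -scalemxAl !trmx_delta -!rowE !mxE.
have huij := ae_orthogonal hsigma (reflection_orthogonal v) uij.
apply: (@filterS2 _ _ (ae_filter_ringOfSetsType sigma)) uij huij => u uij huij Su.
have /eqP := uij Su; rewrite mulf_eq0 => /orP[/eqP //|/eqP uj0].
have subE (c : R) k : (u - c *: v) k 0 = u k 0 - c * v k 0 by rewrite !mxE.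
have := huij Su; rewrite reflection_mul !subE !dotv vi vj uj0.
set a := u i 0 => h; apply/eqP; rewrite -sqrf_eq0; apply/eqP.
have -> : a ^+ 2 = 25 / 12 * 0 by rewrite -h; field.
by rewrite mulr0.
Qed.

(** * Jensen's inequality for the logarithm *)

(** With m the weighted mean, the difference ln m - sum_i w_i ln d_i is the sum
    of the terms gap i = w_i ((d_i / m - 1) - ln (d_i / m)).  Each is
    nonnegative as ln x <= x - 1, and it vanishes only if w_i = 0 or d_i = m,
    since ln x = x - 1 only at x = 1. *)
Lemma ln_jensen (R : realType) (I : finType) (w d : I -> R) :
  (forall i, 0 <= w i) -> \sum_i w i = 1 -> (forall i, 0 < d i) ->
  let m := \sum_i w i * d i in
  [/\ 0 < m, \sum_i w i * ln (d i) <= ln m &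
    \sum_i w i * ln (d i) = ln m -> forall i, w i != 0 -> d i = m].
Proof.
move=> w0 w1 d0 m.
have m0 : 0 < m.
  rewrite lt_def; apply/andP; split; last first.
    by apply: sumr_ge0 => i _; rewrite mulr_ge0 // ltW.
  apply/negP => /eqP m_eq0.
  have wd0 i : true -> 0 <= w i * d i by move=> _; rewrite mulr_ge0 // ltW.
  have /eqP := oner_neq0 R; apply; rewrite -w1; apply: big1 => i _; apply/eqP.
  have /eqP := psumr_eq0P wd0 m_eq0 (erefl true : (fun _ : I => true) i).
  by rewrite mulf_eq0 (gt_eqF (d0 i)) orbF.
pose gap i := w i * (d i / m - 1 - (ln (d i) - ln m)).
have lnq i : ln (d i / m) = ln (d i) - ln m.
  by rewrite lnM ?posrE ?invr_gt0 // lnV ?posrE.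
have q0 i : 0 < d i / m by rewrite divr_gt0.
have gap0 i : 0 <= gap i.
  apply: mulr_ge0 => //; rewrite -lnq subr_ge0.
  have /le_ln1Dx : -1 < d i / m - 1 by rewrite ltrBDl subrr.
  by rewrite addrC subrK.
have gapE : \sum_i gap i = ln m - \sum_i w i * ln (d i).
  transitivity (m^-1 * m - 1 + ln m * \sum_i w i - \sum_i w i * ln (d i)).
    rewrite -{1}w1 /m !mulr_sumr -!sumrB -!big_split -sumrB /=.
    by apply: eq_bigr => i _; rewrite /gap; ring.
  by rewrite mulVf ?gt_eqF // subrr add0r w1 mulr1.
split=> //.
  by rewrite -subr_ge0 -gapE sumr_ge0.
move=> eqm i wi.
have gap_eq0 : \sum_i gap i = 0 by rewrite gapE eqm subrr.
have /eqP := psumr_eq0P (fun j _ => gap0 j) gap_eq0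
  (erefl true : (fun _ : I => true) i).
rewrite mulf_eq0 (negbTE wi) /= -lnq subr_eq0 => /eqP e.
have [l0|lN0] := eqVneq (ln (d i / m)) 0.
  have : d i / m = 1 by apply/eqP; rewrite -subr_eq0 e l0.
  by move=> /(congr1 (fun x => x * m)); rewrite mul1r divfK ?gt_eqF.
by have := expR_gt1Dx lN0; rewrite lnK ?posrE // -e addrC subrK ltxx.
Qed.

(** * The integral of the logarithm of the norm *)

(** Jensen's inequality with the weights u_i^2.  The two crude bounds serve to
    make both sides integrable; the upper one on ln |M u|^2 comes from
    ln x <= x. *)
Lemma log_norm_diag (R : realType) (n : nat) (M : 'M[R]_n) (d : 'rV[R]_n)
    (u : 'cV[R]_n) :
  M^T *m M = diag_mx d -> (forall i, 0 < d 0 i) -> unit_sphere u ->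
  let G := \sum_i 2^-1 * ln (d 0 i) * u i 0 ^+ 2 in
  [/\ G <= ln (enorm (M *m u)),
    `|ln (enorm (M *m u))| <= \sum_i `|ln (d 0 i)| + \sum_i d 0 i,
    `|G| <= \sum_i `|ln (d 0 i)| &
    ln (enorm (M *m u)) = G ->
      forall i, u i 0 != 0 -> d 0 i = dot (M *m u) (M *m u)].
Proof.
move=> MM d0 Su G.
have w0 i : 0 <= u i 0 ^+ 2 by exact: sqr_ge0.
have w1 : \sum_i u i 0 ^+ 2 = 1.
  by move/unit_sphereE: Su => <-; rewrite dotE; apply: eq_bigr.
have mE : dot (M *m u) (M *m u) = \sum_i u i 0 ^+ 2 * d 0 i.
  rewrite dot_mulmx mulmxA MM dotE; apply: eq_bigr => i _.
  by rewrite mul_diag_mx mxE; ring.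
have [] := ln_jensen w0 w1 d0; rewrite -mE => m0 jensen eq_case.
have lnE : ln (enorm (M *m u)) = 2^-1 * ln (dot (M *m u) (M *m u)).
  rewrite enormE -{2}(sqr_sqrtr (ltW m0)) lnXn ?sqrtr_gt0 // -[ln _ *+ 2]mulr_natl.
  by rewrite mulKf ?pnatr_eq0.
have GE : G = 2^-1 * \sum_i u i 0 ^+ 2 * ln (d 0 i).
  by rewrite /G mulr_sumr; apply: eq_bigr => i _; ring.
have sum_abs : `|\sum_i u i 0 ^+ 2 * ln (d 0 i)| <= \sum_i `|ln (d 0 i)|.
  apply: (le_trans (ler_norm_sum _ _ _)); apply: ler_sum => i _.
  by rewrite normrM ger0_norm // ler_piMl // coord_sqr_le1.
have ln_up : ln (dot (M *m u) (M *m u)) <= \sum_i d 0 i.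
  apply: (le_trans (ltW (ln_sublinear m0))); rewrite mE; apply: ler_sum => i _.
  by rewrite ler_piMl ?coord_sqr_le1 // ltW.
have sumd0 : 0 <= \sum_i d 0 i by apply: sumr_ge0 => i _; exact: ltW.
have sumln0 : 0 <= \sum_i `|ln (d 0 i)| by exact: sumr_ge0.
split.
- by rewrite GE lnE ler_pM2l ?invr_gt0.
- rewrite lnE; move: sum_abs; rewrite !ler_norml => /andP[lo _].
  apply/andP; split; lra.
- by rewrite GE normrM ger0_norm ?invr_ge0 //; move: sum_abs; lra.
rewrite lnE GE => /mulfI e i ui; apply: eq_case; rewrite ?sqrf_eq0 //.
by apply/esym/e; rewrite invr_eq0 pnatr_eq0.
Qed.

(** Subtracting the sum of the (1/2) u_i^2 ln d_i, whose integral is 0, leaves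
    the integral unchanged and makes the integrand nonnegative; the integral
    then vanishes only if the new integrand does almost everywhere. *)
Lemma log_integral_diag (R : realType) (n : nat)
    (sigma : {measure set (borelRn R n) -> \bar R}) (M : 'M[R]_n) (d : 'rV[R]_n) :
  rotation_invariant_on_sphere sigma ->
  M^T *m M = diag_mx d -> (forall i, 0 < d 0 i) -> \prod_i d 0 i = 1 ->
  let I := (\int[sigma]_(u in @unit_sphere R n) (ln (enorm (M *m u)))%:E)%E in
  (0 <= I)%E /\ (I = 0%E -> forall i, d 0 i = 1).
Proof.
move=> hsigma MM d0 d1 I; have mS := @unit_sphere_measurable R n.
pose F (u : borelRn R n) : R := ln (enorm (M *m u)).
pose G (u : borelRn R n) : R :=
  \sum_i 2^-1 * ln (d 0 i) * (u : 'cV[R]_n) i 0 ^+ 2.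
have key u (Su : unit_sphere u) := log_norm_diag MM d0 Su.
have mF : measurable_fun setT F.
  exact: (measurableT_comp (@measurable_ln R) (enorm_mulmx_measurable M)).
have mG : measurable_fun setT G.
  apply: measurable_sum => i; apply: measurable_funM => //.
  exact: coord_sqr_measurable.
have iF : sigma.-integrable (@unit_sphere R n) (EFin \o F).
  by apply: (sphere_integrable hsigma mF) => u /key[_ + _ _]; exact.
have iG : sigma.-integrable (@unit_sphere R n) (EFin \o G).
  by apply: (sphere_integrable hsigma mG) => u /key[_ _ + _]; exact.
have ln_prod : \sum_i ln (d 0 i) = 0.
  apply: expR_inj; rewrite expR_sum expR0 -[RHS]d1.
  by apply: eq_bigr => i _; rewrite lnK ?posrE.
have G0 : (\int[sigma]_(u in @unit_sphere R n) (G u)%:E = 0)%E.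
  have [k|noI] := pickP (fun _ : 'I_n => true).
    by rewrite (integral_sum_coord_sqr _ k hsigma) -mulr_sumr ln_prod mulr0 mul0e.
  apply: integral0_eq => u _; rewrite /G big1 // => i _.
  by have := noI i.
have IE : (I = \int[sigma]_(u in @unit_sphere R n) (F u - G u)%:E)%E.
  by rewrite -[LHS]sube0 -G0 -(integralB_EFin mS iF iG).
have FG0 u : unit_sphere u -> (0 <= (F u - G u)%:E)%E.
  by move=> /key[+ _ _ _]; rewrite lee_fin subr_ge0.
split; first by rewrite IE; exact: integral_ge0.
rewrite IE => I0.
have ae_eqFG : \forall u \ae sigma, unit_sphere u -> F u = G u.
  have mFG : measurable_fun (@unit_sphere R n : set (borelRn R n))
      (fun u => (F u - G u)%:E).
    by apply/measurable_EFinP; apply: measurable_funTS; exact: measurable_funB.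
  have : (\int[sigma]_(u in @unit_sphere R n) `|(F u - G u)%:E| = 0)%E.
    rewrite -[RHS]I0; apply: eq_integral => u; rewrite inE => Su.
    by rewrite gee0_abs // FG0.
  move=> /(ae_eq_integral_abs sigma mS mFG).
  apply: (@filterS _ _ (ae_filter_ringOfSetsType sigma)) => u + Su.
  by move=> /(_ Su) /eqP; rewrite /cst /= eqe subr_eq0 => /eqP.
have d_const i j : d 0 i = d 0 j.
  have [->//|ij] := eqVneq i j.
  apply/eqP; apply: contraPT (coord_mul_not_ae_eq0 hsigma ij) => dij; apply.
  apply: (@filterS _ _ (ae_filter_ringOfSetsType sigma)) ae_eqFG => u FG Su.
  have [_ _ _ eq_case] := key u Su; have := eq_case (FG Su) => dm.
  apply/eqP; rewrite mulf_eq0; apply: contraNT dij; rewrite negb_or => /andP[ui uj].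
  by rewrite (dm i ui) (dm j uj).
move=> i; have := ln_prod; rewrite (eq_bigr (fun=> ln (d 0 i))); last first.
  by move=> j _; rewrite (d_const j i).
rewrite sumr_const card_ord => /eqP; rewrite mulrn_eq0 => /orP[/eqP n0|/eqP ln0].
  by have := ltn_ord i; rewrite {2}n0.
by apply: ln_inj; rewrite ?posrE // ln1.
Qed.

Theorem theorem3 (R : realType) (n : nat) (hn : (1 <= n)%N)
    (sigma : {measure set (borelRn R n) -> \bar R})
    (hsigma : rotation_invariant_on_sphere sigma)
    (A : 'M[R]_n) (hA : \det A = 1) :
  (0 <= \int[sigma]_(u in @unit_sphere R n) (ln (enorm (A *m u)))%:E)%E /\
  ((\int[sigma]_(u in @unit_sphere R n) (ln (enorm (A *m u)))%:E = 0)%E <->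
   A^T *m A = 1%:M).
Proof.
have [|Q [d [QQ AE]]] := @symmetric_diagonalization R n (A^T *m A).
  by rewrite trmx_mul trmxK.
have QQ' : Q *m Q^T = 1%:M by exact: mulmx1C.
pose M := A *m Q^T.
have MM : M^T *m M = diag_mx d.
  rewrite /M trmx_mul trmxK mulmxA -(mulmxA Q) AE !mulmxA QQ' mul1mx.
  by rewrite -mulmxA QQ' mulmx1.
have d1 : \prod_i d 0 i = 1.
  have detQ : \det Q * \det Q = 1 by rewrite -{1}det_tr -det_mulmx QQ det1.
  have := congr1 determinant AE; rewrite !det_mulmx !det_tr hA mulr1 det_diag.
  by rewrite mulrAC detQ mul1r => <-.
have d0 i : 0 < d 0 i.
  rewrite lt_def; apply/andP; split.
    apply/eqP => di; have := oner_neq0 R.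
    by rewrite -d1 (bigD1 i) //= di mul0r eqxx.
  have <- : dot (M *m delta_mx i 0) (M *m delta_mx i 0) = d 0 i.
    rewrite dot_mulmx mulmxA MM /dot trmx_delta -rowE !mxE.
    rewrite (bigD1 i) //= big1 => [|j ji]; rewrite !mxE ?eqxx ?mulr1n ?mulr1 ?addr0 //.
    by rewrite (negbTE ji) mulr0.
  exact: dot_ge0.
have rotate : (\int[sigma]_(u in @unit_sphere R n) (ln (enorm (M *m u)))%:E =
    \int[sigma]_(u in @unit_sphere R n) (ln (enorm (A *m u)))%:E)%E.
  rewrite -(integral_orthogonal (Q := Q^T) (f := fun u => ln (enorm (A *m u)))
    (C := \sum_i `|ln (d 0 i)| + \sum_i d 0 i) hsigma).
  - by apply: eq_integral => u _; rewrite /M mulmxA.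
  - by rewrite trmxK.
  - exact: (measurableT_comp (@measurable_ln R) (enorm_mulmx_measurable A)).
  move=> u Su; have SQu : unit_sphere (Q *m u) by apply/orthogonal_sphere.
  have [_ + _ _] := log_norm_diag MM d0 SQu.
  by rewrite /M !mulmxA -(mulmxA A) QQ mulmx1.
have [ge0 eq0] := log_integral_diag hsigma MM d0 d1.
rewrite rotate in ge0 eq0.
split=> //; split=> [/eq0 dE|AA].
  have -> : A^T *m A = Q^T *m 1%:M *m Q.
    rewrite AE; congr (_ *m _ *m _).
    by apply/matrixP => i j; rewrite !mxE dE.
  by rewrite mulmx1.
apply: integral0_eq => u /unit_sphereE uu.
by rewrite enormE dot_mulmx mulmxA AA mul1mx uu sqrtr1 ln1.
Qed.
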